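(* For the ordinal matroid secretary problem on arbitrary matroids of rank $\rho$, there exists an $O(\log\log\rho)$ ordinal-competitive algorithm and there exists an $O(\log\rho)$ probability-competitive algorithm.
   Context: Ordinal MSP: $\mathcal{M}=(R,\mathcal{I})$ is a matroid with $|R|=n$ and rank $\rho$, $\succ$ a total order on $R$. For $Q\subseteq R$, $\mathrm{OPT}(Q)$ is the greedy (lexicographically maximum w.r.t. $\succ$) base of $Q$ and $\mathrm{OPT}=\mathrm{OPT}(R)$. Elements arrive in uniformly random order; the algorithm knows $n$, can only compare revealed elements under $\succ$ and query independence of sets of revealed elements, and must irrevocably accept or reject each element on arrival, keeping the accepted set $\mathrm{ALG}$ independent. An algorithm is $\alpha$ ordinal-competitive if for every weight function $w:R\to\mathbb{R}_{\ge0}$ compatible with $\succ$ (i.e. $r\succ r'\Rightarrow w(r)\ge w(r')$), $\mathbb{E}[w(\mathrm{ALG})]\ge w(\mathrm{OPT})/\alpha$. It is $\alpha$ probability-competitive if $\Pr(e\in\mathrm{ALG})\ge1/\alpha$ for every $e\in\mathrm{OPT}$. *)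

(* Defs.v *)
(* MathComp world: matroids are on finite types, the reals are an arbitrary
   realType. *)
From mathcomp Require Import all_boot all_order all_algebra.
From mathcomp Require Import reals.

Set Implicit Arguments.
Unset Strict Implicit.
Unset Printing Implicit Defensive.

Import Order.TTheory GRing.Theory Num.Theory.
Local Open Scope ring_scope.

Record matroid (T : finType) := Matroid {
  indep : {set {set T}};
  indep_set0 : set0 \in indep;
  indep_sub : forall I J : {set T}, J \in indep -> I \subset J -> I \in indep;
  indep_augment : forall I J : {set T}, I \in indep -> J \in indep ->
    (#|I| < #|J|)%N -> exists2 x, x \in J :\: I & x |: I \in indep
}.

Definition rank (T : finType) (M : matroid T) : nat :=
  \max_(I in indep M) #|I|.

(* The order on the ground set is that of the finOrderType; larger elements
   are preferred, i.e. "x is better than y" is (y < x)%O, so the greedy base of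
   Q scans Q from the largest element to the smallest. *)
Definition OPT d (T : finOrderType d) (M : matroid T) (Q : {set T}) : {set T} :=
  foldl (fun B x => if x |: B \in indep M then x |: B else B)
        set0 (sort >=%O (enum Q)).

(* sigma i is the i-th arriving element; when #|T| = n these are exactly the
   orderings of T. *)
Definition arrival_orders n (T : finType) : {set {ffun 'I_n -> T}} :=
  [set sigma : {ffun 'I_n -> T} | injectiveb sigma].

(* What has been revealed when the t-th element has arrived: the independent
   sets among the elements arrived so far, and the comparisons between them.
   Elements are named by their arrival positions, so nothing else about the
   ground set is visible. *)
Definition seen_indep n (T : finType) (M : matroid T)
    (sigma : {ffun 'I_n -> T}) (t : 'I_n) : {set {set 'I_n}} :=
  [set I : {set 'I_n} |
    (I \subset [set i : 'I_n | (i <= t)%N]) && (sigma @: I \in indep M)].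

Definition seen_order n d (T : finOrderType d)
    (sigma : {ffun 'I_n -> T}) (t : 'I_n) : {set 'I_n * 'I_n} :=
  [set ij : 'I_n * 'I_n |
    [&& (ij.1 <= t)%N, (ij.2 <= t)%N & (sigma ij.2 < sigma ij.1)%O]].

(* A randomized ordinal online algorithm for ground sets of size n.  All the
   randomness is drawn at the start as a seed, independently of the arrival
   order; a finite seed set is no restriction, since for fixed n there are
   finitely many deterministic decision rules.  Past decisions need not be
   passed to [accept]: they are a function of the seed and of the current
   information. *)
Record algorithm (R : realType) (n : nat) := Algorithm {
  seed : finType;
  seed_prob : seed -> R;
  seed_prob_ge0 : forall s, 0 <= seed_prob s;
  seed_prob_sum : \sum_s seed_prob s = 1;
  accept : seed -> 'I_n -> {set {set 'I_n}} -> {set 'I_n * 'I_n} -> bool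
}.

Section Run.
Context (R : realType) (n : nat) (A : algorithm R n).
Context (d : Order.disp_t) (T : finOrderType d) (M : matroid T).

Definition ALG (s : seed A) (sigma : {ffun 'I_n -> T}) : {set T} :=
  [set sigma t | t : 'I_n &
    accept s t (seen_indep M sigma t) (seen_order sigma t)].

(* Expectation of X(ALG) over the seed and the uniformly random arrival order. *)
Definition expect_ALG (X : {set T} -> R) : R :=
  \sum_(s : seed A) seed_prob s *
    ((\sum_(sigma in arrival_orders n T) X (ALG s sigma))
       / #|arrival_orders n T|%:R).

Definition prob_in_ALG (e : T) : R := expect_ALG (fun Q => (e \in Q)%:R).

Definition keeps_independent : Prop :=
  forall (s : seed A) (sigma : {ffun 'I_n -> T}),
    sigma \in arrival_orders n T -> ALG s sigma \in indep M.

Definition weight (w : T -> R) (Q : {set T}) : R := \sum_(x in Q) w x.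

Definition compatible (w : T -> R) : Prop :=
  (forall x, 0 <= w x) /\ (forall x y, (y < x)%O -> w y <= w x).

(* Positivity of alpha is required because alpha^-1 is 0 at alpha = 0. *)
Definition ordinal_competitive (alpha : R) : Prop :=
  0 < alpha /\
  forall w, compatible w ->
    weight w (OPT M [set: T]) / alpha <= expect_ALG (weight w).

Definition probability_competitive (alpha : R) : Prop :=
  0 < alpha /\
  forall e, e \in OPT M [set: T] -> 1 / alpha <= prob_in_ALG e.

End Run.

(* The algorithm is told n only, so one family (A n)_n must serve every matroid;
   alpha gives the competitive ratio as a function of the rank. *)
Definition ordinal_competitive_family (R : realType)
    (A : forall n, algorithm R n) (alpha : nat -> R) : Prop :=
  forall n d (T : finOrderType d) (M : matroid T), #|T| = n ->
    keeps_independent (A n) M /\ ordinal_competitive (A n) M (alpha (rank M)).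

Definition probability_competitive_family (R : realType)
    (A : forall n, algorithm R n) (alpha : nat -> R) : Prop :=
  forall n d (T : finOrderType d) (M : matroid T), #|T| = n ->
    keeps_independent (A n) M /\ probability_competitive (A n) M (alpha (rank M)).

(* Main.v *)
(* Split the ground set at random into a sample A, a second sample B and the
   candidates. An element is active when it improves on the part of A above it,
   and its level is g (rank of that part of A): g is the identity for the
   probability version (about rank-many levels) and the bit length for the
   ordinal version (about log-rank-many levels). Grouping levels into dyadic
   blocks of length 2^k, the algorithm handles the blocks independently: an
   accepted element is spanned by the part of B in its own and earlier blocks, and
   independent of the part of B in strictly earlier blocks together with the
   candidates of its own block that arrived before it; for k > 0 only the left
   half of each block is used. The scale k is uniform, so the ratio is the number
   of scales, i.e. the logarithm of the number of levels.

   Fix A and e in OPT, and let P_k(B) say that e is spanned by the part of B in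
   its own and earlier blocks at scale k. Exchanging B with the candidates inside
   the block of e is measure preserving and turns the event that e is blocked at
   scale k+1 into P_k. Hence e is accepted at scale k+1 with probability at least
   Pr(P_{k+1}) - Pr(P_k), and this telescopes to 1 - Pr(P_0). In the ordinal case
   the missing Pr(P_0) is recovered at scale 0, where the number of accepted
   elements of a level is at least the number of its optimal candidates satisfying
   P_0; counting a level inside a fixed upward closed set Q loses only a constant
   factor, because levels grow geometrically, and Abel summation over such Q suffices.
   In the probability case P_0 fails as soon as the first element below e that
   improves on the part of A above it belongs to A, an event of constant probability. *)
Require Import Defs.
From mathcomp Require Import all_boot all_order all_fingroup all_algebra.
From mathcomp Require Import reals topology normedtype sequences landau exp.
From mathcomp Require Import zify ring lra.
Import Order.TTheory GRing.Theory Num.Theory.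
Import numFieldNormedType.Exports.
Set Implicit Arguments.
Unset Strict Implicit.
Unset Printing Implicit Defensive.

(** * Rank and span in a matroid *)

(** Taken for a bare family of sets, so that the algorithm can apply it to the independent sets of
    positions revealed so far. *)
Definition family_rank (X : finType) (F : {set {set X}}) (S : {set X}) : nat :=
  \max_(I in F | I \subset S) #|I|.

Section MatroidRank.
Context (T : finType) (M : matroid T).
Implicit Types (S I J : {set T}) (x y : T).

Definition rk S := family_rank (indep M) S.
Definition spans (r : {set T} -> nat) S x := r (x |: S) == r S.

Lemma rk_ge I S : I \in indep M -> I \subset S -> #|I| <= rk S.
Proof.
move=> iI sI; apply: (@leq_bigmax_cond _
  [pred I : {set T} | (I \in indep M) && (I \subset S)] (fun I : {set T} => #|I|)).
by rewrite /= iI.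
Qed.

Lemma rk_basis S : exists I, [/\ I \in indep M, I \subset S & #|I| = rk S].
Proof.
have [|I /andP[iI sI] e] := @eq_bigmax_cond _
   [pred I : {set T} | (I \in indep M) && (I \subset S)] (fun I : {set T} => #|I|).
  by apply/card_gt0P; exists set0; rewrite !inE indep_set0 sub0set.
by exists I; split=> //; rewrite /rk /family_rank e; apply: eq_bigl.
Qed.

Lemma basis_extension I S : I \in indep M -> I \subset S ->
  exists J, [/\ J \in indep M, I \subset J, J \subset S & #|J| = rk S].
Proof.
have [k] := ubnP (rk S - #|I|); elim: k I => // k IH I lek iI sI.
have [ltI|geI] := ltnP #|I| (rk S); last first.
  by exists I; split=> //; apply/eqP; rewrite eqn_leq geI rk_ge.
have [J [iJ sJ eJ]] := rk_basis S.
have [|x /setDP[xJ xI] iI'] := indep_augment iI iJ; first by rewrite eJ.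
have sI' : x |: I \subset S by rewrite subUset sub1set (subsetP sJ).
have [|J' [? sI'' ? ?]] := IH _ _ iI' sI'.
  by rewrite cardsU1 xI; lia.
by exists J'; split=> //; apply: subset_trans sI''; apply: subsetUr.
Qed.

Lemma rk_mono S S' : S \subset S' -> rk S <= rk S'.
Proof.
move=> sSS'; have [I [iI sI <-]] := rk_basis S.
exact: rk_ge iI (subset_trans sI sSS').
Qed.

Lemma rk_le_card S : rk S <= #|S|.
Proof. by have [I [_ sI <-]] := rk_basis S; apply: subset_leq_card. Qed.

Lemma indep_rk S : (S \in indep M) = (rk S == #|S|).
Proof.
apply/idP/eqP=> [iS|eS]; first by apply/eqP; rewrite eqn_leq rk_le_card rk_ge.
have [I [iI sI eI]] := rk_basis S.
suff -> : S = I by [].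
by apply/esym/eqP; rewrite eqEcard sI eI eS /=.
Qed.

Lemma rk_rank S : rk S <= rank M.
Proof.
have [I [iI _ <-]] := rk_basis S.
exact: (@leq_bigmax_cond _ (mem (indep M)) (fun I : {set T} => #|I|)).
Qed.

Lemma rkU1 x S : rk (x |: S) <= (rk S).+1.
Proof.
have [I [iI sI <-]] := rk_basis (x |: S).
have iI' : I :\ x \in indep M by apply: indep_sub iI (subD1set _ _).
have sI' : I :\ x \subset S by rewrite subDset.
by have := rk_ge iI' sI'; rewrite (cardsD1 x I); case: (x \in I) => /=; lia.
Qed.

Lemma rkU S S' : rk (S :|: S') <= rk S + #|S'|.
Proof.
have [k] := ubnP #|S'|; elim: k S' => // k IH S' lek.
have [->|[x xS']] := set_0Vmem S'; first by rewrite setU0 leq_addr.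
rewrite -(setD1K xS') setUCA cardsU1 !inE eqxx /=.
have := rkU1 x (S :|: S' :\ x); have := IH (S' :\ x).
by have := cardsD1 x S'; rewrite xS'; lia.
Qed.

Lemma spansN S x : ~~ spans rk S x = (rk (x |: S) == (rk S).+1).
Proof.
rewrite /spans; have := rkU1 x S; have := rk_mono (subsetUr [set x] S).
by lia.
Qed.

Lemma mem_spans S x : x \in S -> spans rk S x.
Proof. by move=> xS; rewrite /spans (setUidPr _) ?sub1set. Qed.

(** Extend a basis [I] of [S] to a basis of [S'] and then to one of [x |: S']. If the rank grows in
    the last step, the final basis contains [x] and [I], so [x |: I] is independent and [x] is not
    spanned by [S]. *)
Lemma spans_mono S S' x : S \subset S' -> spans rk S x -> spans rk S' x.
Proof.
move=> sSS'; apply: contraTT; rewrite spansN => /eqP e'.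
have [I [iI sI eI]] := rk_basis S.
have [J [iJ sIJ sJ eJ]] := basis_extension iI (subset_trans sI sSS').
have [J' [iJ' sJJ' sJ' eJ']] := basis_extension iJ (subset_trans sJ (subsetUr [set x] S')).
have xJ' : x \in J'.
  apply: contraT => xJ'; suff /(rk_ge iJ') : J' \subset S' by lia.
  apply/subsetP=> y yJ'; have /setU1P[yx|//] := subsetP sJ' _ yJ'.
  by rewrite -yx yJ' in xJ'.
have xI : x \notin I.
  apply/negP=> xI; have xS' := subsetP sSS' _ (subsetP sI _ xI).
  by move: e'; rewrite (setUidPr _) ?sub1set // => /n_Sn.
rewrite /spans; suff : (rk S).+1 <= rk (x |: S) by lia.
have <- : #|x |: I| = (rk S).+1 by rewrite cardsU1 xI eI.
apply: rk_ge; last exact: setUS.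
apply: indep_sub iJ' _; rewrite subUset sub1set xJ' /=.
exact: subset_trans sIJ sJJ'.
Qed.

Lemma rk_spanned S S' : (forall y, y \in S' -> spans rk S y) ->
  rk (S :|: S') = rk S.
Proof.
move=> sp; have [I [iI sI eI]] := rk_basis S.
have [J [iJ sIJ sJ eJ]] := basis_extension iI (subset_trans sI (subsetUl S S')).
rewrite -eJ -eI; suff -> : J = I by [].
apply/eqP; rewrite eqEsubset sIJ andbT; apply/subsetP=> y yJ; apply: contraT=> yI.
have iy : y |: I \in indep M by apply: indep_sub iJ _; rewrite subUset sub1set yJ.
have: spans rk S y.
  by have /setUP[/mem_spans|/sp] := subsetP sJ _ yJ.
rewrite /spans => /eqP e; have := rk_ge iy (setUS [set y] sI).
by rewrite e cardsU1 yI eI ltnn.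
Qed.

Lemma spans_closure S S' x : (forall y, y \in S' -> spans rk S y) ->
  spans rk S' x -> spans rk S x.
Proof.
move=> sp /(spans_mono (subsetUr S S')); rewrite /spans (rk_spanned sp) => /eqP e.
rewrite eqn_leq (rk_mono (subsetUr _ S)) andbT -[leqRHS]e.
by rewrite rk_mono // setUS ?subsetUl.
Qed.

(** Adding the elements of [E] by increasing key, each one raises the rank by one. *)
Lemma rk_keyed (key : T -> nat) (F E : {set T}) : {in E &, injective key} ->
  (forall x, x \in E -> ~~ spans rk (F :|: [set y in E | key y < key x]) x) ->
  rk (F :|: E) = rk F + #|E|.
Proof.
have [k] := ubnP #|E|; elim: k E => // k IH E lek inj free.
have [->|[x0 x0E]] := set_0Vmem E; first by rewrite setU0 cards0 addn0.
have [x xE xmax] : exists2 x, x \in E & forall y, y \in E -> key y <= key x.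
  by have [x xE xmax] := arg_maxnP key x0E; exists x.
have eE : E :\ x = [set y in E | key y < key x].
  apply/setP=> y; rewrite !inE andbC; have [yE|//] := boolP (y \in E).
  rewrite ltn_neqAle (xmax y yE) !andbT; congr (~~ _).
  by apply/eqP/eqP=> [->//|]; apply: inj.
have cE := cardsD1 x E; rewrite xE in cE.
rewrite -(setD1K xE) setUCA.
have /eqP-> : rk (x |: (F :|: E :\ x)) == (rk (F :|: E :\ x)).+1.
  by rewrite -spansN eE free.
rewrite IH; first 1 last.
- by lia.
- by move=> y z /setD1P[_ yE] /setD1P[_ zE]; apply: inj.
- move=> y /setD1P[_ yE]; apply: contra (free y yE); apply: spans_mono.
  by apply/setUS/subsetP=> z; rewrite !inE => /andP[/andP[_ ->] ->].
by rewrite setD1K // cE addnS.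
Qed.

Lemma spans_indep I x : I \in indep M -> x \notin I ->
  spans rk I x = (x |: I \notin indep M).
Proof.
move=> iI xI; rewrite [x |: I \in _]indep_rk -[LHS]negbK spansN cardsU1 xI.
by move: iI; rewrite indep_rk => /eqP->.
Qed.

End MatroidRank.

(** * The greedy base *)

Section GreedyBase.
Context (d : Order.disp_t) (T : finOrderType d) (M : matroid T).
Implicit Types (x y z : T) (s : seq T).

Definition above x := [set y | (x < y)%O].

Let greedy s := foldl (fun B x => if x |: B \in indep M then x |: B else B) set0 s.

Let greedyP s : sorted >%O s ->
  [/\ greedy s \in indep M, {subset greedy s <= s},
      forall x, x \in greedy s -> ~~ spans (rk M) [set y in s | (x < y)%O] x &
      forall x, x \in s -> spans (rk M) [set y in greedy s | (x <= y)%O] x].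
Proof.
elim/last_ind: s => [_|s z IH].
  by split=> [|x||]; rewrite /greedy /= ?indep_set0 // ?inE // => x; rewrite inE.
move=> sz; have ss : sorted >%O s.
  by move: sz; rewrite -cats1 => /cat_sorted2[].
have zlt : {in s, forall y, (z < y)%O}.
  move=> y ys; move: sz; rewrite -cats1 sorted_pairwise; last first.
    by move=> a b c /= ba cb; apply: lt_trans cb ba.
  by rewrite pairwise_cat => /and3P[/allrelP/(_ y z ys) H _ _]; apply: H; rewrite inE.
have {IH} [iB sB free full] := IH ss.
have spB x : x \in s -> spans (rk M) (greedy s) x.
  by move=> /full; apply: spans_mono; apply/subsetP=> y; rewrite inE => /andP[].
have eg : greedy (rcons s z) = if z |: greedy s \in indep M then z |: greedy s else greedy s.
  by rewrite /greedy -cats1 foldl_cat.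
have zB : z \notin greedy s by apply/negP=> /sB /zlt; rewrite ltxx.
have eqs x : x \in s -> [set y in rcons s z | (x < y)%O] = [set y in s | (x < y)%O].
  move=> xs; apply/setP=> y; rewrite !inE mem_rcons inE.
  by case: (eqVneq y z) => [->|_] /=; rewrite ?(lt_gtF (zlt _ xs)) ?andbF.
rewrite eg; case: ifPn => iz; split=> //.
- by move=> y /setU1P[->|/sB ys]; rewrite mem_rcons inE ?eqxx ?ys ?orbT.
- move=> x /setU1P[->|xB]; last by rewrite eqs ?sB // free.
  have := spans_indep iB zB; rewrite iz /= => /negbT; apply: contra.
  apply: spans_closure => y; rewrite inE mem_rcons inE => /andP[/predU1P[->|/spB //]].
  by rewrite ltxx.
- move=> x; rewrite mem_rcons => /predU1P[->|/full].
    by apply: mem_spans; rewrite !inE eqxx lexx.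
  by apply: spans_mono; apply/subsetP=> y; rewrite !inE => /andP[-> ->]; rewrite orbT.
- by move=> y /sB ys; rewrite mem_rcons inE ys orbT.
- by move=> x xB; rewrite eqs ?sB // free.
- move=> x; rewrite mem_rcons => /predU1P[->|/full//].
  have := spans_indep iB zB; rewrite iz; apply: spans_mono.
  by apply/subsetP=> y yB; rewrite !inE yB ltW // zlt // sB.
Qed.

Let OPT_greedy : exists s, [/\ OPT M [set: T] = greedy s, sorted >%O s & s =i T].
Proof.
exists (sort >=%O (enum [set: T])); split=> //.
  rewrite -[sorted _ _](rev_sorted <%O) lt_sorted_uniq_le rev_uniq sort_uniq.
  rewrite enum_uniq rev_sorted sort_sorted // => x y.
  by rewrite /= le_total.
by move=> x; rewrite mem_sort mem_enum inE.
Qed.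

Lemma OPT_indep : OPT M [set: T] \in indep M.
Proof. by have [s [-> /greedyP[]]] := OPT_greedy. Qed.

Lemma OPT_not_spanned x : x \in OPT M [set: T] -> ~~ spans (rk M) (above x) x.
Proof.
have [s [-> /greedyP[_ _ free _] es]] := OPT_greedy => /free.
by congr (~~ spans _ _ _); apply/setP=> y; rewrite !inE es.
Qed.

(** The greedy base restricted to any upper segment is a base of that segment. *)
Lemma rk_above x : rk M (above x) = #|OPT M [set: T] :&: above x|.
Proof.
have iO : OPT M [set: T] :&: above x \in indep M := indep_sub OPT_indep (subsetIl _ _).
rewrite -(eqP (etrans (esym (indep_rk _ _)) iO)).
have [s [-> /greedyP[_ _ _ full] es]] := OPT_greedy.
rewrite -[RHS](@rk_spanned _ M _ (above x)).
  by congr (rk _ _); apply/esym/setUidPr/subsetIr.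
move=> y; rewrite inE => xy; have := full y (es y).
apply: spans_mono; apply/subsetP=> z; rewrite !inE => /andP[-> yz].
exact: lt_le_trans xy yz.
Qed.

End GreedyBase.

(** * The acceptance rule for an abstract rank function and comparison *)

Section Rule.
Context (X : finType) (r : {set X} -> nat) (better : rel X) (g : nat -> nat).
Implicit Types (A B E : {set X}) (x y : X) (k : nat).

Definition sample_above A x := [set y in A | better y x].
Definition active A x := (x \notin A) && ~~ spans r (sample_above A x) x.
Definition level A x := g (r (sample_above A x)).
Definition block A k x := level A x %/ 2 ^ k.
Definition num_levels A := (g (r A)).+1.
(** The largest scale [k] satisfies [num_levels A < 2 ^ k], so there [closed_by] holds for every
    element. *)
Definition num_scales A := (up_log 2 (num_levels A).+1).+1.

Definition below A B k b := [set y in B | active A y && (block A k y < b)].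

(* In the last block no span condition is imposed, as no later block has to
   be protected. *)
Definition closed_by A B k x :=
  (num_levels A < (block A k x).+1 * 2 ^ k) ||
  spans r (below A B k (block A k x).+1) x.

Definition eligible A B k x :=
  [&& active A x, x \notin B, (k > 0) ==> ~~ odd (block A k.-1 x) &
      closed_by A B k x].

(* [E] is the set of elements that arrived before [x]. Testing against all earlier
   eligible elements instead of the accepted ones gives the same span as the
   greedy algorithm without any recursion. *)
Definition rule A B k E x :=
  eligible A B k x &&
  ~~ spans r (below A B k (block A k x) :|:
              [set y in E | eligible A B k y && (block A k y == block A k x)]) x.

Lemma half_block A k x : (block A k x)./2 = block A k.+1 x.
Proof. by rewrite -divn2 /block -divnMA expnSr. Qed.

End Rule.

(** The elements of [S] failing [P] are images under [f] of elements satisfying it. This is the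
    source of every event of probability at least one half below. *)
Lemma card_involution (X : finType) (f : X -> X) (S : {set X}) (P : pred X) :
  involutive f -> {in S, forall x, (f x \in S) && (P x || P (f x))} ->
  #|S| <= 2 * #|[set x in S | P x]|.
Proof.
move=> fK fS; set Q := [set x in S | P x].
have sub : S \subset Q :|: f @: Q.
  apply/subsetP=> x xS; have /andP[fxS] := fS x xS; rewrite !inE xS /=.
  case/orP=> [->//|Pf]; apply/orP; right; apply/imsetP; exists (f x) => //.
  by rewrite inE fxS.
apply: leq_trans (subset_leq_card sub) _; apply: leq_trans (leq_card_setU _ _) _.
by rewrite mul2n -addnn leq_add2l leq_imset_card.
Qed.

Definition symdiff (X : finType) (W B : {set X}) := [set x | (x \in W) != (x \in B)].

Lemma symdiffK (X : finType) (W : {set X}) : involutive (symdiff W).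
Proof. by move=> B; apply/setP=> x; rewrite !inE; case: (x \in W); case: (x \in B). Qed.

(** * The rule on a matroid: independence, exchange argument, lonely elements *)

Section RuleOnMatroid.
Context (d : Order.disp_t) (T : finOrderType d) (M : matroid T).
Context (g : nat -> nat) (g_homo : {homo g : m n / m <= n}).
Implicit Types (A B E : {set T}) (x y e : T) (k : nat).

Local Notation r := (rk M).
Local Notation better := (fun y x : T => (x < y)%O).
Local Notation sample_above := (sample_above better).
Local Notation active := (active r better).
Local Notation level := (level r better g).
Local Notation block := (block r better g).
Local Notation num_levels := (num_levels r g).
Local Notation num_scales := (num_scales r g).
Local Notation below := (below r better g).
Local Notation closed_by := (closed_by r better g).
Local Notation eligible := (eligible r better g).
Local Notation rule := (rule r better g).
Local Notation OPT := (OPT M [set: T]).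

Definition accepted A B k (pos : T -> nat) :=
  [set x | rule A B k [set y | pos y < pos x] x].

Lemma sample_above_sub A x y : (x <= y)%O -> sample_above A y \subset sample_above A x.
Proof.
by move=> xy; apply/subsetP=> z; rewrite !inE => /andP[-> /(le_lt_trans xy)].
Qed.

Lemma level_homo A x y : (x <= y)%O -> level A y <= level A x.
Proof. by move=> xy; apply/g_homo/rk_mono/sample_above_sub. Qed.

Lemma level_lt A x : level A x < num_levels A.
Proof. by rewrite ltnS; apply/g_homo/rk_mono/subsetP=> y; rewrite inE => /andP[]. Qed.

Lemma below_sub A B k b b' : b <= b' -> below A B k b \subset below A B k b'.
Proof.
move=> bb'; apply/subsetP=> x; rewrite !inE => /andP[-> /andP[-> xb]] /=.
exact: leq_trans xb bb'.
Qed.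

Lemma OPT_active A e : e \in OPT -> e \notin A -> active A e.
Proof.
move=> /OPT_not_spanned eO eA; rewrite /active eA /=; apply: contra eO.
by apply: spans_mono; apply/subsetP=> y; rewrite !inE => /andP[].
Qed.

(** Order the accepted elements by block, then by arrival. Predecessors of [x] in earlier blocks are
    spanned by the part of [B] before the block of [x], and those in the same block belong to the
    set tested by [rule]; so [x] is not spanned by its predecessors. *)
Lemma accepted_indep A B k pos : injective pos -> accepted A B k pos \in indep M.
Proof.
move=> pos_inj; set S := accepted A B k pos.
pose m := \max_(x : T) (pos x).+1.
have pos_lt x : pos x < m by rewrite /m; apply: (@leq_bigmax_cond _ xpredT (fun x => (pos x).+1)).
pose key x := block A k x * m + pos x.
have key_div x : key x %/ m = block A k x.
  have m0 : 0 < m by apply: leq_ltn_trans (pos_lt x).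
  by rewrite /key divnMDl // divn_small ?addn0.
rewrite indep_rk -[S in rk _ S]set0U (@rk_keyed _ _ key).
- by rewrite (eqP (etrans (esym (indep_rk _ _)) (indep_set0 M))) cards0.
- move=> x y _ _ exy; have eb : block A k x = block A k y by rewrite -!key_div exy.
  by apply: pos_inj; move: exy; rewrite /key eb => /addnI.
move=> x; rewrite inE => /andP[_]; apply: contra; rewrite set0U.
apply: spans_closure => y; rewrite inE => /andP[yS kyx].
have eby : eligible A B k y by move: yS; rewrite inE => /andP[].
have := leq_div2r m (ltnW kyx); rewrite !key_div leq_eqVlt => /orP[/eqP eb|lb].
  apply: mem_spans; rewrite !inE eby eb eqxx andbT; apply/orP; right.
  by move: kyx; rewrite /key eb ltn_add2l => ->.
(* The exemption for the last block cannot apply to [y]: the block of [x] would start beyond all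
   levels. *)
have := eby; rewrite /eligible /closed_by => /and4P[_ _ _ /orP[|]].
  move=> last; have := level_lt A x.
  have := leq_trunc_div (level A x) (2 ^ k); rewrite -/(block A k x).
  have : (block A k y).+1 * 2 ^ k <= block A k x * 2 ^ k by rewrite leq_mul2r lb orbT.
  by lia.
apply: spans_mono; apply: subset_trans (subsetUl _ _).
exact: below_sub.
Qed.

(** Fix a level, and let [F] be the part of [B] of smaller level. Members of [F] are better than the
    optimal elements of the level, so the latter are independent over [F]. They are eligible, hence
    spanned by [F] and the accepted elements of the level; comparing ranks over [F] bounds their
    number. *)
Lemma accepted_scale0 A B pos (Q : {set T}) :
  injective pos ->
  #|[set e in OPT | [&& e \notin A, e \notin B, closed_by A B 0 e &
      [forall y, active A y && (level A y == level A e) ==> (y \in Q)]]]| <=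
  #|accepted A B 0 pos :&: Q|.
Proof.
move=> pos_inj; set D := [set e in OPT | _]; set S := _ :&: Q.
have fib (S' : {set T}) : #|S'| = \sum_(i < num_levels A) #|[set x in S' | level A x == i]|.
  rewrite -sum1_card (partition_big (fun x => Ordinal (level_lt A x)) xpredT) //=.
  by apply: eq_bigr => i _; rewrite -sum1_card; apply: eq_bigl => x; rewrite !inE.
rewrite !fib; apply: leq_sum => i _.
set Di := [set x in D | _]; set Si := [set x in S | _].
have [->|[e0 e0D]] := set_0Vmem Di; first by rewrite cards0.
have blk0 x : block A 0 x = level A x by rewrite /block expn0 divn1.
pose F := below A B 0 i.
have Qi y : active A y -> level A y = i -> y \in Q.
  move=> ya yi; move: e0D; rewrite !inE => /andP[/and5P[_ _ _ _ /forallP/(_ y)/implyP H] /eqP e0i].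
  by apply: H; rewrite ya yi e0i eqxx.
(* Induction on arrival: an eligible element that is rejected is spanned by [F] and earlier eligible
   elements. *)
have El_span x : eligible A B 0 x -> level A x = i -> spans r (F :|: Si) x.
  have [k] := ubnP (pos x); elim: k x => // k IH x lek ex xi.
  have [ax|] := boolP (x \in accepted A B 0 pos).
    apply: mem_spans; rewrite !inE; move: ax; rewrite inE => ->.
    by rewrite xi eqxx Qi ?orbT //; case/andP: ex.
  rewrite inE /rule ex /= negbK; apply: spans_closure => y.
  rewrite blk0 xi => /setUP[yF|]; first by apply: mem_spans; apply/setUP; left.
  rewrite !inE blk0 => /andP[yx /andP[ey /eqP yi]].
  by apply: IH => //; apply: leq_trans yx _; rewrite -ltnS.
have D_El e : e \in Di -> eligible A B 0 e /\ level A e = i.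
  rewrite !inE => /andP[/and5P[eO eA eB ec _] /eqP ei].
  by rewrite /eligible OPT_active // eB ec.
have := @rk_spanned _ M (F :|: Si) Di (fun e eD => El_span e (D_El e eD).1 (D_El e eD).2).
have := rk_mono M (setSU Di (subsetUl F Si)); have := rkU M F Si.
suff -> : r (F :|: Di) = r F + #|Di| by lia.
apply: (@rk_keyed _ _ (fun x => #|[set y : T | (x < y)%O]|)).
  have key_lt x y : (x < y)%O -> #|[set z | (y < z)%O]| < #|[set z | (x < z)%O]|.
    move=> xy; apply/proper_card/properP; split; last by exists y; rewrite inE ?ltxx.
    by apply/subsetP=> z; rewrite !inE; apply: lt_trans.
  by move=> x y _ _ exy; case: (ltgtP x y) => // /key_lt; rewrite exy ltnn.
move=> e eD; have eO : e \in OPT by move: eD; rewrite !inE => /andP[/andP[]].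
have [_ ei] := D_El e eD.
apply: contra (OPT_not_spanned eO); apply: spans_mono.
apply/subsetP=> y /setUP[|].
  rewrite !inE blk0 -ei => /andP[_ /andP[_]]; rewrite ltnNge; apply: contraR.
  by rewrite -leNgt => /level_homo.
rewrite !inE => /andP[_]; rewrite ltnNge; apply: contraR; rewrite -leNgt => ye.
apply/subset_leq_card/subsetP=> z; rewrite !inE; exact: le_lt_trans.
Qed.

(* Exchanging [B] with the candidates inside the window turns the elements that
   can block [e] at scale [k] into the elements of [B] that could span [e] at scale
   [k.-1]; [wins] is the resulting sufficient condition for accepting [e]. *)
Definition window A k e := [set y | [&& active A y, block A k y == block A k e & y != e]].

Definition wins A B k e :=
  if k is k'.+1 then
    [&& e \notin B, ~~ odd (block A k' e), closed_by A B k e &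
        ~~ spans r (below A (symdiff (window A k e) B) k' (block A k' e).+1) e]
  else false.

(** All possible blockers of [e] lie in the set tested by [wins]. Elements of [B] in earlier blocks
    are outside the window and stay in [B]; candidates of the block of [e] are switched into [B],
    and the parity test places them in the same half as [e]. *)
Lemma wins_accepted A B k pos e :
  active A e -> wins A B k e -> e \in accepted A B k pos.
Proof.
case: k => // k ae /and4P[eB even ce free].
rewrite inE /rule /eligible ae eB even ce /=; apply: contra free; apply: spans_mono.
apply/subsetP=> y /setUP[]; rewrite !inE -!half_block.
  move=> /andP[yB /andP[ya lt]]; rewrite ya yB /=.
  have -> : block A k y < (block A k e).+1 by lia.
  by rewrite andbT eqb_id negb_and; apply/orP; left; lia.
move=> /andP[pye /andP[/and4P[ya yB oy _] /eqP ee]]; rewrite ya (negPf yB) /=.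
rewrite ee eqxx eqbF_neg negbK /=; apply/andP; split; last by move: oy even ee => /=; lia.
by apply: contraTneq pye => ->; rewrite ltnn.
Qed.

Definition avoiding e := [set B : {set T} | e \notin B].

Lemma card_avoiding e : 2 * #|avoiding e| = 2 ^ #|T|.
Proof.
have -> : avoiding e = powerset [set~ e].
  by apply/setP=> B; rewrite !inE subsetC sub1set inE.
by rewrite card_powerset cardsC1 -expnS prednK //; apply/card_gt0P; exists e.
Qed.

Lemma wins_step A k e :
  #|[set B in avoiding e | closed_by A B k.+1 e]| <=
  #|[set B in avoiding e | wins A B k.+1 e]| +
  #|[set B in avoiding e | closed_by A B k e]|.
Proof.
(* In a right half, the block of [e] and the block containing it at the next scale end at the same
   level, so [closed_by] does not change. *)
have [odde|evene] := boolP (odd (block A k e)).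
  apply: leq_trans (leq_addl _ _); apply/subset_leq_card/subsetP=> B.
  rewrite !inE => /andP[-> /=]; rewrite /closed_by -!half_block.
  have -> : ((block A k e)./2).+1 * 2 ^ k.+1 = (block A k e).+1 * 2 ^ k.
    by rewrite expnS mulnA; congr (_ * _); lia.
  case/orP=> [->//|sp]; apply/orP; right; move: sp; congr (spans _ _ _).
  apply/setP=> y; rewrite !inE -half_block; do 2!congr (_ && _).
  by apply/idP/idP; lia.
(* In a left half, the exchange inside [W] sends each closed but not winning [B] to a set closed at
   scale [k]; it preserves [avoiding e] because [e] is not in [W]. *)
set W := window A k.+1 e; pose Z := [set B in avoiding e | closed_by A B k e].
have eW : e \notin W by rewrite !inE !eqxx /= andbF.
have <- : #|symdiff W @: Z| = #|Z| by apply/card_imset/inv_inj/symdiffK.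
apply: leq_trans (leq_card_setU _ _); apply/subset_leq_card/subsetP=> B.
rewrite !inE => /andP[eB ce]; rewrite /wins evene eB ce /=.
case: (boolP (spans _ _ _)) => //= sp.
apply/imsetP; exists (symdiff W B); rewrite ?symdiffK // inE /closed_by sp orbT andbT.
by rewrite [_ \in avoiding e]inE [e \in symdiff _ _]inE (negPf eW) (negPf eB).
Qed.

(** Telescoping of [wins_step], started at the largest scale, where [closed_by] always holds. *)
Lemma sum_wins A e :
  #|avoiding e| <= \sum_(k < num_scales A) #|[set B in avoiding e | wins A B k e]| +
                   #|[set B in avoiding e | closed_by A B 0 e]|.
Proof.
pose P k := #|[set B in avoiding e | closed_by A B k e]|.
have tele j : P j <= \sum_(k < j.+1) #|[set B in avoiding e | wins A B k e]| + P 0.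
  elim: j => [|j IH]; first exact: leq_addl.
  rewrite big_ord_recr /= addnAC; have := wins_step A j e; rewrite -!/(P _).
  by move: IH; rewrite /=; lia.
apply: leq_trans (tele _); apply/subset_leq_card/subsetP=> B eB.
rewrite !inE in eB *; rewrite eB /closed_by.
have := @up_logP 2 (num_levels A).+1 isT.
by move=> /leq_trans->; rewrite // leq_pmull.
Qed.

(** Under the hypothesis, the part of [B] up to the level of [e] lies above [e], and such elements
    cannot span an element of the greedy base. *)
Lemma closed_by_scale0 A B e : e \in OPT -> e \notin B ->
  (forall y, active A y -> (y < e)%O -> level A e < level A y) ->
  ~~ closed_by A B 0 e.
Proof.
move=> eO eB lonely; rewrite /closed_by /block expn0 divn1 muln1 negb_or -leqNgt level_lt /=.
apply: contra (OPT_not_spanned eO); apply: spans_mono; apply/subsetP=> y.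
rewrite !inE /block expn0 divn1 => /andP[yB /andP[ay yle]].
case: ltgtP => // [/(lonely y ay)|ye]; first by rewrite ltnNge -ltnS yle.
by rewrite ye yB in eB.
Qed.

Lemma sum_wins_lonely A e : e \in OPT ->
  (forall y, active A y -> (y < e)%O -> level A e < level A y) ->
  #|avoiding e| <= \sum_(k < num_scales A) #|[set B in avoiding e | wins A B k e]|.
Proof.
move=> eO lonely; have := sum_wins A e.
rewrite [X in _ + X](_ : _ = 0) ?addn0 //; apply/eqP; rewrite cards_eq0; apply/eqP/setP=> B.
rewrite !inE; apply/negP=> /andP[eB]; apply/negP; exact: closed_by_scale0.
Qed.

Definition lonely A e :=
  [forall y, active A y && (y < e)%O ==> (r (sample_above A e) < r (sample_above A y))].

(* Toggling the membership in [A] of the best element below [e] that the sample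
   above it does not span is an involution, and [e] is lonely whenever that element
   lies in [A]. *)
Lemma card_lonely e :
  #|avoiding e| <= 2 * #|[set A in avoiding e | lonely A e]|.
Proof.
pose improving A := [pred y | (y < e)%O && ~~ spans r (sample_above A y) y].
have next_uniq A y z : improving A y -> improving A z ->
    (forall t, improving A t -> (t <= y)%O) ->
    (forall t, improving A t -> (t <= z)%O) -> y = z.
  by move=> iy iz my mz; apply: le_anti; rewrite mz ?my.
pose is_next A y := improving A y && [forall t, improving A t ==> (t <= y)%O].
pose f A := if [pick y | is_next A y] is Some y then symdiff [set y] A else A.
have nextP A : improving A =1 xpred0 \/ exists y, is_next A y.
  have [y iy|no] := pickP (improving A); last by left.
  right; have [z iz mz] := arg_maxP id iy.
  by exists z; rewrite /is_next iz; apply/forallP=> t; apply/implyP=> /mz.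
have fE A y : is_next A y -> f A = symdiff [set y] A.
  move=> ny; rewrite /f; case: pickP => [z nz|/(_ y)]; last by rewrite ny.
  have /andP[iy /forallP my] := ny; have /andP[iz /forallP mz] := nz.
  by rewrite (next_uniq A y z) // => t ?; [apply: (implyP (my t))|apply: (implyP (mz t))].
(* Whether [y] is next depends only on the sample strictly above [y] and above larger elements, so
   toggling [y] does not affect it. *)
have above_eq A y z : (y <= z)%O -> sample_above (symdiff [set y] A) z = sample_above A z.
  move=> yz; apply/setP=> t; rewrite !inE; case: (eqVneq t y) => [->|]; last by case: (t \in A).
  by rewrite (le_gtF yz) !andbF.
have is_next_toggle A y : is_next A y -> is_next (symdiff [set y] A) y.
  move=> /andP[/andP[ye iy] /forallP my]; rewrite /is_next /= ye above_eq // iy /=.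
  apply/forallP=> t; apply/implyP=> /andP[te]; apply: contraR; rewrite -ltNge => yt.
  rewrite above_eq ?ltW //; apply/negPn/negP=> it.
  by have /= := my t; rewrite te it /= leNgt yt.
have fK : involutive f.
  move=> A; have [no|[y ny]] := nextP A.
    have e0 : f A = A by rewrite /f; case: pickP => // y /andP[]; rewrite no.
    by rewrite !e0.
  by rewrite (fE A y ny) (fE _ y (is_next_toggle A y ny)) symdiffK.
have lonely_next A y : is_next A y -> y \in A -> lonely A e.
  move=> /andP[/andP[ye iy] /forallP my] yA.
  apply/forallP=> z; apply/implyP=> /andP[/andP[zA iz] ze].
  have zy : (z < y)%O.
    rewrite lt_neqAle; have /= := my z; rewrite ze iz /= => ->; rewrite andbT.
    by apply: contraNneq zA => ->.
  (* An active [z] below [e] is even below [y], and [y] raises the rank of the sample above [e]. *)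
  have sub : y |: sample_above A e \subset sample_above A z.
    by rewrite subUset sub1set inE yA zy sample_above_sub // ltW.
  apply: leq_trans (rk_mono M sub); suff : ~~ spans r (sample_above A e) y.
    by rewrite spansN => /eqP->.
  by apply: contra iy; apply/spans_mono/sample_above_sub/ltW.
apply: card_involution fK _ => A; rewrite !inE => eA.
have [no|[y ny]] := nextP A.
  have -> : f A = A by rewrite /f; case: pickP => // y /andP[]; rewrite no.
  rewrite eA /= orbb; apply/forallP=> y; apply/implyP=> /andP[/andP[_ iy] ye].
  by have := no y; rewrite /= ye iy.
have ye : y == e = false by case/andP: ny => /andP[/lt_eqF].
rewrite (fE A y ny) !inE [e == y]eq_sym ye (negPf eA) /=.
have [yA|yA] := boolP (y \in A); first by rewrite (lonely_next A y).
apply/orP; right; apply: (lonely_next _ y); first exact: is_next_toggle.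
by rewrite !inE eqxx yA.
Qed.

End RuleOnMatroid.

(** * Invariance of the rule under relabelling *)

Section Transport.
Context (X Y : finType) (f : X -> Y) (f_inj : injective f) (g : nat -> nat).
Context (rX : {set X} -> nat) (rY : {set Y} -> nat) (bX : rel X) (bY : rel Y).
Context (D A B E : {set X}) (k : nat).
Context (rXY : forall I : {set X}, I \subset D -> rX I = rY (f @: I)).
Context (bXY : forall x y, x \in D -> y \in D -> bX y x = bY (f y) (f x)).
Context (AD : A \subset D) (BD : B \subset D) (ED : E \subset D).

Let imset_sep (S : {set X}) (P : pred X) (Q : pred Y) :
  {in S, forall x, P x = Q (f x)} ->
  f @: [set x in S | P x] = [set y in f @: S | Q y].
Proof.
move=> PQ; apply/setP=> y; rewrite inE; apply/imsetP/andP.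
  by case=> x; rewrite inE => /andP[xS Px] ->; rewrite imset_f // -PQ.
by case=> /imsetP[x xS ->] Qx; exists x; rewrite // inE xS PQ.
Qed.

Let sepD (S : {set X}) (P : pred X) : S \subset D -> [set x in S | P x] \subset D.
Proof. by apply: subset_trans; apply/subsetP=> x; rewrite inE => /andP[]. Qed.

Let spansE (S : {set X}) x : S \subset D -> x \in D ->
  spans rX S x = spans rY (f @: S) (f x).
Proof. by move=> SD xD; rewrite /spans !rXY ?imsetU1 // subUset sub1set xD. Qed.

Let sample_aboveE x : x \in D ->
  f @: sample_above bX A x = sample_above bY (f @: A) (f x).
Proof. by move=> xD; apply: imset_sep => y /(subsetP AD) yD; apply: bXY. Qed.

Let activeE x : x \in D -> active rX bX A x = active rY bY (f @: A) (f x).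
Proof.
by move=> xD; rewrite /active mem_imset // -sample_aboveE // spansE // sepD.
Qed.

Let blockE j x : x \in D -> block rX bX g A j x = block rY bY g (f @: A) j (f x).
Proof.
by move=> xD; rewrite /block /level rXY ?sample_aboveE // sepD.
Qed.

Let belowE j b : f @: below rX bX g A B j b = below rY bY g (f @: A) (f @: B) j b.
Proof. by apply: imset_sep => y /(subsetP BD) yD; rewrite activeE // blockE. Qed.

Let eligibleE x : x \in D ->
  eligible rX bX g A B k x = eligible rY bY g (f @: A) (f @: B) k (f x).
Proof.
move=> xD; rewrite /eligible activeE // mem_imset // blockE //.
by rewrite /closed_by /num_levels rXY // blockE // -belowE spansE // sepD.
Qed.

Lemma num_scales_transport : num_scales rX g A = num_scales rY g (f @: A).
Proof. by rewrite /num_scales /num_levels rXY. Qed.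

(** Turns the decision made on arrival positions into the rule on the elements. Ranks and
    comparisons need only agree on the revealed positions [D]. *)
Lemma rule_transport x : x \in D ->
  rule rX bX g A B k E x = rule rY bY g (f @: A) (f @: B) k (f @: E) (f x).
Proof.
move=> xD; rewrite /rule eligibleE // spansE //; last by rewrite subUset !sepD.
rewrite imsetU belowE blockE //.
congr (_ && ~~ spans _ (_ :|: _) _).
by apply: imset_sep => y /(subsetP ED) yD; rewrite eligibleE // blockE.
Qed.

End Transport.

(** * Random labels and the online algorithm *)

(* A position labelled (a, b) goes to the sample [A] if [a], to [B] if [b] only, and
   is a candidate otherwise. *)
Definition seed_labels n := {ffun 'I_n -> bool * bool}.

Definition sample_first : rel (bool * bool) :=
  fun l m => (m.1 || m.2) ==> (l.1 || l.2).

(* Independent labels rearranged so that the sampled positions come first; since the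
   arrival order is uniform, the elements still receive independent labels. *)
Definition sorted_labels n (L : seed_labels n) (i : 'I_n) : bool * bool :=
  nth (false, false) (sort sample_first (codom L)) i.

Lemma sorted_labels_perm n (L : seed_labels n) :
  exists p : {perm 'I_n}, forall i, sorted_labels L i = L (p i).
Proof.
have : perm_eq (sort sample_first (codom L)) [tuple L i | i < n].
  by rewrite perm_sort codomE -val_ord_tuple; apply: perm_refl.
case/tuple_permP=> p e; exists p => i; rewrite /sorted_labels e.
by rewrite -[LHS](@tnth_nth n) !tnth_mktuple.
Qed.

Lemma sorted_labels_sample n (L : seed_labels n) (i j : 'I_n) : i <= j ->
  (sorted_labels L j).1 || (sorted_labels L j).2 ->
  (sorted_labels L i).1 || (sorted_labels L i).2.
Proof.
move=> ij; apply/implyP.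
have tr : transitive sample_first by move=> [[] []] [[] []] [[] []].
have rf : reflexive sample_first by move=> [[] []].
have tot : total sample_first by move=> [[] []] [[] []].
have sz : size (sort sample_first (codom L)) = n by rewrite size_sort size_codom card_ord.
by apply: (sorted_leq_nth tr rf (false, false) (sort_sorted tot (codom L))); rewrite ?inE ?sz.
Qed.

(** The value of [num_scales] for a sample of rank [m]. *)
Definition scale_bound (g : nat -> nat) m := (up_log 2 (g m).+2).+1.

Lemma scale_bound_homo g : {homo g : m n / m <= n} ->
  {homo scale_bound g : m n / m <= n}.
Proof. by move=> gh m n mn; rewrite /scale_bound ltnS leq_up_log // !ltnS gh. Qed.

Lemma sum_mod (V : nmodType) (F : nat -> V) K M :
  (\sum_(u < M * K) F (u %% K)%N = (\sum_(k < K) F k) *+ M)%R.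
Proof.
elim: M => [|M IH]; first by rewrite big_ord0 mulr0n.
rewrite mulSn big_split_ord mulrS -IH /=; congr (_ + _)%R; apply: eq_bigr => i _ /=.
  by rewrite modn_small.
by rewrite modnDl.
Qed.

Section BlockAlgorithm.
Context (R : realType) (g : nat -> nat) (n : nat).
Local Open Scope ring_scope.

(* The number of scales is known only after sampling; reduced modulo any number up to
   [scale_bound g n], a uniform element of ['I_((scale_bound g n)`!)] stays uniform. *)
Definition block_seed : finType := (seed_labels n * 'I_((scale_bound g n)`!))%type.

Definition labelled (L : seed_labels n) (c : bool * bool -> bool) :=
  [set i | c (sorted_labels L i)].

Definition block_accept (s : block_seed) (t : 'I_n)
    (I : {set {set 'I_n}}) (O : {set 'I_n * 'I_n}) : bool :=
  let A := labelled s.1 fst in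
  rule (family_rank I) (fun y x => (y, x) \in O) g A (labelled s.1 snd)
    (s.2 %% num_scales (family_rank I) g A)%N [set i : 'I_n | (i < t)%N] t.

Lemma card_block_seed : #|block_seed| = (4 ^ n * (scale_bound g n)`!)%N.
Proof. by rewrite card_prod card_ffun card_prod card_bool !card_ord. Qed.

Lemma block_seed_prob_sum : \sum_(s : block_seed) (#|block_seed|%:R : R)^-1 = 1.
Proof.
rewrite sumr_const -[LHS]mulr_natl divff // pnatr_eq0 card_block_seed.
by rewrite -lt0n muln_gt0 expn_gt0 fact_gt0.
Qed.

Definition block_algorithm : algorithm R n :=
  @Algorithm R n block_seed (fun _ => #|block_seed|%:R^-1)
    (fun _ => etrans (invr_ge0 _) (ler0n _ _)) block_seed_prob_sum block_accept.

End BlockAlgorithm.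

(** * Running the algorithm on a random order *)

Section BlockAlgorithmRun.
Context (R : realType) (g : nat -> nat) (g_homo : {homo g : m n / m <= n}).
Context (d : Order.disp_t) (T : finOrderType d) (M : matroid T) (n : nat).
Context (cardT : #|T| = n).
Implicit Types (sigma : {ffun 'I_n -> T}).

Lemma family_rank_seen sigma (t : 'I_n) (I : {set 'I_n}) :
  injective sigma -> I \subset [set i : 'I_n | i <= t] ->
  family_rank (seen_indep M sigma t) I = rk M (sigma @: I).
Proof.
move=> inj It; apply/eqP; rewrite eqn_leq; apply/andP; split.
  apply/bigmax_leqP=> J /andP[]; rewrite inE => /andP[_ iJ] JI.
  by rewrite -(card_imset (mem J) inj); apply: rk_ge iJ (imsetS _ JI).
have [J [iJ JI <-]] := rk_basis M (sigma @: I).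
have JE : J = sigma @: (sigma @^-1: J).
  apply/setP=> y; apply/idP/imsetP=> [yJ|[i]]; last by rewrite inE => ? ->.
  by have /imsetP[i iI e] := subsetP JI y yJ; exists i; rewrite // inE -e.
have sub : sigma @^-1: J \subset I.
  by apply/subsetP=> i; rewrite inE => /(subsetP JI); rewrite mem_imset.
rewrite JE card_imset //; apply: (@leq_bigmax_cond _
  [pred J : {set 'I_n} | (J \in seen_indep M sigma t) && (J \subset I)]
  (fun J : {set 'I_n} => #|J|)).
by rewrite /= sub inE -JE iJ (subset_trans sub It).
Qed.

Lemma block_ALG (s : seed (block_algorithm R g n)) sigma :
  sigma \in arrival_orders n T ->
  exists2 pos : T -> nat, injective pos &
    ALG M s sigma = accepted M g (sigma @: labelled s.1 fst) (sigma @: labelled s.1 snd)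
      (s.2 %% num_scales (rk M) g (sigma @: labelled s.1 fst)) pos.
Proof.
rewrite inE => /injectiveP inj.
have [|h hK Kh] := inj_card_bij inj; first by rewrite cardT card_ord.
exists (fun x => h x : nat); first by move=> x y /val_inj/(can_inj Kh).
apply/setP=> x; rewrite -[x]Kh; set t := h x.
rewrite /ALG mem_imset // inE.
set A := labelled _ _; set B := labelled _ _.
have arrE : [set y | h y < h (sigma t)] = sigma @: [set i : 'I_n | i < t].
  by apply/setP=> y; rewrite inE hK -[y in RHS]Kh mem_imset // inE.
rewrite inE arrE /= /block_accept -/A -/B.
(* A sampled position is rejected on both sides. Otherwise all sampled positions precede [t], so the
   revealed data determine the rule. *)
have [tAB|tAB] := boolP ((t \in A) || (t \in B)).
  rewrite /rule /eligible /active !mem_imset //.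
  by case/orP: tAB => ->; rewrite /= ?andbF.
pose D := [set i : 'I_n | i <= t].
have sampleD (c : bool * bool -> bool) :
    (forall l : bool * bool, c l -> l.1 || l.2) -> labelled s.1 c \subset D.
  move=> cl; apply/subsetP=> i; rewrite !inE => /cl il; rewrite leqNgt.
  apply: contra tAB => ti; rewrite !inE; exact: sorted_labels_sample (ltnW ti) il.
have AD : A \subset D by apply: sampleD => l ->.
have BD : B \subset D by apply: sampleD => l ->; rewrite orbT.
have rE (I : {set 'I_n}) : I \subset D ->
  family_rank (seen_indep M sigma t) I = rk M (sigma @: I) := family_rank_seen inj.
rewrite (num_scales_transport g rE AD).
apply: (@rule_transport _ _ _ inj g _ _ _ (fun y x : T => (x < y)%O) D A B
  [set i : 'I_n | i < t] _ rE _ AD BD) => [i j||]; rewrite ?inE //.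
- by move=> it jt; rewrite it jt.
- by apply/subsetP=> i; rewrite !inE => /ltnW.
Qed.

Lemma block_keeps_independent : keeps_independent (block_algorithm R g n) M.
Proof.
move=> s sigma /(block_ALG s)[pos inj ->]; exact: accepted_indep.
Qed.

Local Open Scope ring_scope.

(** The permutation that sorts the labels is absorbed by the uniform arrival order; for a fixed
    order, labellings correspond to pairs [(A, B)]. *)
Lemma sum_labels (H : {set T} -> {set T} -> R) :
  \sum_(L : seed_labels n) \sum_(sigma in arrival_orders n T)
     H (sigma @: labelled L fst) (sigma @: labelled L snd) =
  #|arrival_orders n T|%:R * \sum_A \sum_B H A B.
Proof.
transitivity (\sum_(L : seed_labels n) \sum_(sigma in arrival_orders n T)
     H (sigma @: [set i | (L i).1]) (sigma @: [set i | (L i).2])).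
  apply: eq_bigr => L _; have [p pE] := sorted_labels_perm L.
  rewrite (reindex (fun tau : {ffun 'I_n -> T} => [ffun i => tau (p i)])) /=; last first.
    exists (fun tau : {ffun 'I_n -> T} => [ffun i => tau ((p^-1)%g i)]) => tau _;
    by apply/ffunP=> i; rewrite !ffunE ?permK ?permKV.
  apply: eq_big => [tau|tau _].
    rewrite !inE; apply/injectiveP/injectiveP=> inj i j.
      have := inj ((p^-1)%g i) ((p^-1)%g j); rewrite !ffunE !permKV => H' e.
      exact: (can_inj (permKV p)) (H' e).
    by rewrite !ffunE => /inj/perm_inj.
  have im (c : bool * bool -> bool) :
      [ffun i => tau (p i)] @: labelled L c = tau @: [set i | c (L i)].
    apply/setP=> y; apply/imsetP/imsetP=> [[i]|[i]]; rewrite inE => ci ->.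
      by exists (p i); rewrite ?inE -?pE // ffunE.
    by exists ((p^-1)%g i); rewrite ?inE ?pE ?ffunE permKV.
  by rewrite !im.
rewrite exchange_big /= -sum1_card natr_sum mulr_suml.
apply: eq_bigr => sigma; rewrite inE => /injectiveP inj; rewrite mul1r.
have [|h hK Kh] := inj_card_bij inj; first by rewrite cardT card_ord.
rewrite pair_big /=.
rewrite (reindex (fun AB : {set T} * {set T} =>
   [ffun i => (sigma i \in AB.1, sigma i \in AB.2)] : seed_labels n)) /=; last first.
  exists (fun L : seed_labels n => (sigma @: [set i | (L i).1], sigma @: [set i | (L i).2])).
    move=> [A B] _; congr (_, _); apply/setP=> y;
    by rewrite -[y]Kh mem_imset // !inE !ffunE.
  move=> L _; apply/ffunP=> i; rewrite !ffunE !mem_imset // !inE.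
  by case: (L i).
apply: eq_bigr => -[A B] _ /=; congr H; apply/setP=> y;
  by rewrite -[y]Kh mem_imset // !inE !ffunE.
Qed.

Lemma num_scales_bound A m : (rk M A <= m)%N -> (num_scales (rk M) g A <= scale_bound g m)%N.
Proof. exact: (scale_bound_homo g_homo). Qed.

Lemma expect_block_ge (F : {set T} -> R) (G : {set T} -> {set T} -> nat -> nat) :
  (forall A B k pos, injective pos -> (G A B k)%:R <= F (accepted M g A B k pos)) ->
  (\sum_A \sum_B \sum_(k < num_scales (rk M) g A) G A B k)%:R
    / (4 ^ n * scale_bound g (rank M))%:R <= expect_ALG (block_algorithm R g n) M F.
Proof.
move=> GF; set K := num_scales (rk M) g; set N := ((scale_bound g n)`!)%N.
have K0 A : (0 < K A)%N by [].
(* As [K A] divides the factorial [N], each scale below [K A] is the residue of exactly [N %/ K A]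
   seeds. *)
have KN A : (N = N %/ K A * K A)%N.
  rewrite divnK // dvdn_fact // K0 num_scales_bound //.
  by rewrite -cardT; apply: leq_trans (rk_le_card M A) _; apply: max_card.
have orders0 : (0 < #|arrival_orders n T|)%N.
  apply/card_gt0P; exists [ffun i => enum_val (cast_ord (esym cardT) i)].
  rewrite inE; apply/injectiveP=> i j; rewrite !ffunE => /enum_val_inj.
  exact: cast_ord_inj.
have N0 : (0 < N)%N := fact_gt0 _.
apply: (@le_trans _ _ (\sum_(s : block_seed g n) #|block_seed g n|%:R^-1 *
  ((\sum_(sigma in arrival_orders n T)
      (G (sigma @: labelled s.1 fst) (sigma @: labelled s.1 snd)
         (s.2 %% K (sigma @: labelled s.1 fst))%N)%:R) / #|arrival_orders n T|%:R)));
  last first.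
  apply: ler_sum => s _; apply: ler_wpM2l; first by rewrite invr_ge0 ler0n.
  apply: ler_wpM2r; first by rewrite invr_ge0 ler0n.
  apply: ler_sum => sigma /(block_ALG s)[pos inj ->]; exact: GF.
rewrite -mulr_sumr -mulr_suml.
have -> : \sum_(s : block_seed g n) \sum_(sigma in arrival_orders n T)
      (G (sigma @: labelled s.1 fst) (sigma @: labelled s.1 snd)
         (s.2 %% K (sigma @: labelled s.1 fst))%N)%:R =
   \sum_(u < N) #|arrival_orders n T|%:R * \sum_A \sum_B (G A B (u %% K A)%N)%:R :> R.
  rewrite -(pair_big xpredT xpredT (fun L (u : 'I_N) => \sum_(sigma in arrival_orders n T)
     (G (sigma @: labelled L fst) (sigma @: labelled L snd)
         (u %% K (sigma @: labelled L fst))%N)%:R)) /= exchange_big /=.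
  by apply: eq_bigr => u _; rewrite -(sum_labels (fun A B => (G A B (u %% K A)%N)%:R)).
rewrite -mulr_sumr mulrAC divff ?mul1r; last by rewrite pnatr_eq0 -lt0n.
rewrite card_block_seed [in leRHS]exchange_big /= natr_sum mulr_suml mulr_sumr.
apply: ler_sum => A _; rewrite [in leRHS]exchange_big /= natr_sum mulr_suml mulr_sumr.
apply: ler_sum => B _.
have -> : \sum_(u < N) (G A B (u %% K A)%N)%:R =
    (\sum_(k < K A) (G A B k)%:R) *+ (N %/ K A) :> R.
  by rewrite -(sum_mod (fun k => (G A B k)%:R)) -KN.
rewrite -natr_sum -[_ *+ (N %/ _)]mulr_natr mulrCA; apply: ler_wpM2l; first exact: ler0n.
set q := (N %/ K A)%N; have eN : (scale_bound g n)`! = (q * K A)%N := KN A.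
have q0 : (0 < q)%N by move: N0; rewrite /N eN muln_gt0 => /andP[].
have -> : (4 ^ n * (scale_bound g n)`!)%:R^-1 * q%:R = (4 ^ n * K A)%:R^-1 :> R.
  rewrite eN mulnCA natrM invfM mulrAC mulVf ?mul1r //.
  by rewrite pnatr_eq0 -lt0n.
rewrite lef_pV2 ?posrE ?ltr0n ?muln_gt0 ?expn_gt0 //.
by rewrite ler_nat leq_mul2l num_scales_bound ?orbT // rk_rank.
Qed.

End BlockAlgorithmRun.

(** * Counting favourable samples *)

Section Counting.
Context (g : nat -> nat) (g_homo : {homo g : m n / m <= n}).
Context (d : Order.disp_t) (T : finOrderType d) (M : matroid T).
Implicit Types (A B Q : {set T}) (e x y : T) (k : nat).

Local Notation better := (fun y x : T => (x < y)%O).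
Local Notation active := (active (rk M) better).
Local Notation level := (level (rk M) better g).
Local Notation closed_by := (closed_by (rk M) better g).
Local Notation num_scales := (num_scales (rk M) g).
Local Notation wins := (wins M g).
Local Notation accepted := (accepted M g).
Local Notation OPT := (OPT M [set: T]).

Lemma expn4 m : 4 ^ m = 2 ^ m * 2 ^ m.
Proof. by rewrite -expnMn. Qed.

Lemma sum_card (I : finType) (P : I -> {set T} -> bool) (D : {pred I}) :
  \sum_(B : {set T}) #|[set i in D | P i B]| = \sum_(i in D) #|[set B | P i B]|.
Proof.
rewrite (eq_bigr (fun B => \sum_(i in D) P i B)) => [|B _].
  rewrite exchange_big; apply: eq_bigr => i _ /=.
  by rewrite -sum1_card [RHS]big_mkcond; apply: eq_bigr => B _; rewrite inE; case: (P i B).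
rewrite -sum1_card big_mkcond [RHS]big_mkcond; apply: eq_bigr => i _; rewrite inE.
by case: (i \in D); case: (P i B).
Qed.

(** Three factors 1/2 give the 8: [e] is outside [A], [e] is lonely given that, and [e] is outside
    [B]. *)
Lemma count_lonely e : e \in OPT ->
  (forall A y, e \notin A -> lonely M A e -> active A y -> (y < e)%O -> level A e < level A y) ->
  4 ^ #|T| <= 8 * \sum_A \sum_B \sum_(k < num_scales A) (active A e && wins A B k e).
Proof.
move=> eO sep; set Z := [set A in avoiding e | lonely M A e].
have ZE A : A \in Z -> #|avoiding e| <= \sum_B \sum_(k < num_scales A) (active A e && wins A B k e).
  rewrite !inE => /andP[eA lA]; rewrite exchange_big /=.
  apply: leq_trans (sum_wins_lonely g_homo eO (fun y => @sep A y eA lA)) _.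
  apply: leq_sum => k _; rewrite OPT_active //=.
  rewrite -sum1_card big_mkcond; apply: leq_sum => B _; rewrite !inE.
  by case: (wins A B k e); case: (e \in B).
have : #|Z| * #|avoiding e| <= \sum_A \sum_B \sum_(k < num_scales A) (active A e && wins A B k e).
  rewrite -sum_nat_const (bigID (mem Z) xpredT) /=.
  by apply: leq_trans (leq_addr _ _); apply: leq_sum => A /ZE.
have := card_lonely M e; have := card_avoiding e; rewrite -/Z expn4.
by move: #|Z| #|avoiding e| (2 ^ #|T|) => z a p; nia.
Qed.

(** The rank [idx] of an element within [OPT] is injective and, on [OPT :&: Q], smaller than [m]; so
    at most [m - j] of its elements have rank at least [j]. *)
Lemma count_prefix Q j : (forall x y, x \in Q -> (x <= y)%O -> y \in Q) ->
  j <= #|OPT :&: Q| -> j <= #|[set e in OPT :&: Q | #|OPT :&: above e| < j]|.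
Proof.
move=> upQ jm; set m := #|OPT :&: Q|; pose idx e := #|OPT :&: above e|.
have idx_lt e y : y \in OPT -> (e < y)%O -> idx y < idx e.
  move=> yO ey; apply/proper_card/properP; split; last by exists y; rewrite !inE ?yO ?ltxx ?andbF.
  by apply/subsetP=> z; rewrite !inE => /andP[-> /(lt_trans ey)].
have idx_m e : e \in OPT :&: Q -> idx e < m.
  move=> /setIP[eO eQ]; apply/proper_card/properP; split; last first.
    by exists e; rewrite !inE ?eO ?ltxx ?andbF.
  by apply/subsetP=> z; rewrite !inE => /andP[-> /ltW/(upQ _ _ eQ)].
set low := [set e in _ | _]; pose high := (OPT :&: Q) :\: low.
have <- : #|low| + #|high| - #|high| = #|low| by rewrite addnK.
have -> : #|low| + #|high| = m.
  rewrite /m -(cardsID low (OPT :&: Q)) (setIidPr _) //.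
  by apply/subsetP=> e; rewrite inE => /andP[].
suff : #|high| <= m - j by lia.
have idx_inj : {in high &, injective idx}.
  move=> x y; rewrite !inE => /andP[_ /andP[xO _]] /andP[_ /andP[yO _]] exy.
  by case: (ltgtP x y) => // [/(idx_lt _ _ yO)|/(idx_lt _ _ xO)]; rewrite exy ltnn.
have -> : m - j = size (iota j (m - j)) by rewrite size_iota.
rewrite cardE -(size_map idx); apply: uniq_leq_size.
  by rewrite map_inj_in_uniq ?enum_uniq // => x y; rewrite !mem_enum; apply: idx_inj.
move=> x /mapP[e]; rewrite mem_enum => eh ->; rewrite mem_iota.
have eOQ : e \in OPT :&: Q by move: eh => /setDP[].
have := idx_m e eOQ; move: eh; rewrite /high in_setD [_ \in low]inE eOQ -/(idx e) /= => /andP[].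
by lia.
Qed.

Context (g_double : forall a b, 2 * a < b -> g a < g b).

(** If [A] contains more than [2 * a] elements of [D], the sample above any [y] outside [Q] has rank
    over [2 * a], while that above [e] has rank at most [a]; [g_double] then separates the levels.
    Since [D] has at least [4 * a + 1] elements, [A] or its exchange on [D] qualifies. *)
Lemma count_level_inside Q e : (forall x y, x \in Q -> (x <= y)%O -> y \in Q) ->
  e \in OPT :&: Q -> 4 * #|OPT :&: above e| + 2 <= #|OPT :&: Q| ->
  2 ^ #|T| <= 4 * #|[set A in avoiding e |
    [forall y, active A y && (level A y == level A e) ==> (y \in Q)]]|.
Proof.
move=> upQ eOQ; set a := #|OPT :&: above e| => am.
pose D := (OPT :&: Q) :\ e; pose P := [pred A : {set T} | 2 * a < #|A :&: D|].
have cD : 4 * a + 1 <= #|D| by have := cardsD1 e (OPT :&: Q); rewrite eOQ -/D; lia.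
have eD : e \notin D by rewrite !inE eqxx.
have PE A : P A -> e \notin A ->
    [forall y, active A y && (level A y == level A e) ==> (y \in Q)].
  move=> PA eA; apply/forallP=> y; apply/implyP=> /andP[_ /eqP el].
  apply: contraT => yQ; suff : level A e < level A y by rewrite el ltnn.
  have ae : level A e <= g a.
    apply: g_homo; rewrite /a -rk_above; apply: rk_mono.
    by apply/subsetP=> z; rewrite !inE => /andP[].
  apply: leq_ltn_trans ae (g_double _); apply: leq_trans PA _.
  have iAD : A :&: D \in indep M.
    apply: indep_sub (OPT_indep M) _; apply/subsetP=> z; rewrite !inE.
    by case/andP=> _ /andP[_ /andP[]].
  rewrite -(eqP (etrans (esym (indep_rk _ _)) iAD)); apply: rk_mono.
  apply/subsetP=> z; rewrite !inE => /andP[-> /andP[_ /andP[_ zQ]]] /=.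
  by rewrite ltNge; apply: contra yQ; apply: upQ.
have PD A : P A || P (symdiff D A).
  have : #|A :&: D| + #|symdiff D A :&: D| = #|D|.
    rewrite -(cardsID A D) setIC; congr (_ + _); apply: eq_card => z; rewrite !inE.
    by case: (z \in A); case: (z == e); case: (z \in OPT); case: (z \in Q).
  move=> e1; rewrite /P /=; move: e1 cD; move: #|A :&: D| #|symdiff D A :&: D| #|D| => x y z. lia.
have := card_involution (@symdiffK _ D) (S := avoiding e) (P := P).
have -> : (2 ^ #|T| = 2 * #|avoiding e|) by rewrite card_avoiding.
move=> H; rewrite -[4]/(2 * 2) -mulnA leq_pmul2l //.
apply: leq_trans (H _) _ => [A|].
  rewrite inE => eA; rewrite PD andbT [_ \in avoiding e]inE [_ \in symdiff _ _]inE.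
  by rewrite (negPf eD) (negPf eA).
rewrite leq_pmul2l //; apply/subset_leq_card/subsetP=> A; rewrite !inE => /andP[eA PA].
by rewrite eA PE.
Qed.

Lemma count_upset Q : (forall x y, x \in Q -> (x <= y)%O -> y \in Q) ->
  exists G : {set T} -> {set T} -> nat -> nat,
    (forall A B k pos, injective pos -> G A B k <= #|accepted A B k pos :&: Q|) /\
    #|OPT :&: Q| * 4 ^ #|T| <= 64 * \sum_A \sum_B \sum_(k < num_scales A) G A B k.
Proof.
move=> upQ; set m := #|OPT :&: Q|.
have [m0|m1] := posnP m; first by exists (fun _ _ _ => 0); rewrite m0.
(* A single optimal element in [Q] is too few for [count_level_inside]. It is the best element of
   [OPT], with nothing of positive rank above it, so the argument for lonely elements applies. *)
have [m2|m2] := ltnP m 2.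
  have /card_gt0P[e] : 0 < #|[set e in OPT :&: Q | #|OPT :&: above e| < 1]|.
    exact: count_prefix.
  rewrite inE ltnS leqn0 => /andP[/setIP[eO eQ] /eqP e0].
  exists (fun A B k => active A e && wins A B k e); split.
    move=> A B k pos inj; case: (boolP (_ && _)) => //= /andP[ea ew].
    by apply/card_gt0P; exists e; rewrite inE wins_accepted.
  rewrite /=; have := @count_lonely e eO; set S := \sum_A _ => H.
  suff : 4 ^ #|T| <= 8 * S.
    have -> : m = 1 by apply/eqP; rewrite eqn_leq -ltnS m2.
    by rewrite mul1n => /leq_trans; apply; rewrite leq_mul2r orbT.
  apply: H => A y eA /forallP/(_ y)/implyP sep ya ye.
  have : rk M (sample_above better A e) <= 0.
    by rewrite -e0 -rk_above; apply: rk_mono; apply/subsetP=> z; rewrite !inE => /andP[].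
  rewrite leqn0 => /eqP r0; have := sep; rewrite ya ye r0 => /(_ isT) r1.
  by rewrite /level r0; apply: g_double.
pose inside A := [set e in OPT :&: Q | (e \notin A) &&
  [forall y, active A y && (level A y == level A e) ==> (y \in Q)]].
(* Scale 0 has no [wins]; its term is the count from [accepted_scale0], which compensates the
   remainder in [sum_wins]. *)
pose G A B k := #|[set e in inside A | wins A B k e]| +
  (k == 0) * #|[set e in inside A | (e \notin B) && closed_by A B 0 e]|.
exists G; split=> [A B [|k] pos inj|].
- rewrite /G mul1n (_ : [set e in _ | wins A B 0 e] = set0) ?cards0; last first.
    by apply/setP=> e; rewrite !inE andbF.
  apply: leq_trans (@accepted_scale0 _ _ M g g_homo A B pos Q inj).
  apply/subset_leq_card/subsetP=> e.
  by rewrite !inE => /andP[/andP[/andP[-> _] /andP[-> ->]] /andP[-> ->]].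
- rewrite /G mul0n addn0; apply/subset_leq_card/subsetP=> e.
  rewrite inE => /andP[]; rewrite inE => /andP[/setIP[eO eQ] /andP[eA _]] ew.
  by rewrite inE eQ andbT wins_accepted // OPT_active.
have sumG A : 2 ^ #|T| * #|inside A| <= 2 * \sum_B \sum_(k < num_scales A) G A B k.
  pose W e := \sum_(k < num_scales A) #|[set B | wins A B k e]|.
  pose C e := #|[set B : {set T} | (e \notin B) && closed_by A B 0 e]|.
  have -> : \sum_B \sum_(k < num_scales A) G A B k = \sum_(e in inside A) (W e + C e).
    rewrite exchange_big big_split /= /W [X in _ = X + _]exchange_big /=.
    under eq_bigr => k _ do rewrite big_split /= sum_card -big_distrr /= sum_card.
    rewrite big_split /=; congr (_ + _).
    by rewrite big_ord_recl /= mul1n [X in _ + X]big1 ?addn0.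
  rewrite mulnC -sum_nat_const big_distrr /=; apply: leq_sum => e _.
  rewrite -(card_avoiding e) leq_pmul2l //; apply: leq_trans (@sum_wins _ _ M g A e) _.
  apply: leq_add; last by apply/subset_leq_card/subsetP=> B; rewrite !inE.
  by apply: leq_sum => k _; apply/subset_leq_card/subsetP=> B; rewrite !inE => /andP[].
have sum_inside : \sum_A #|inside A| = \sum_(e in OPT :&: Q) #|[set A in avoiding e |
    [forall y, active A y && (level A y == level A e) ==> (y \in Q)]]|.
  by rewrite sum_card; apply: eq_bigr => e _; apply: eq_card => A; rewrite !inE.
(* The first [j] optimal elements satisfy the bound of [count_level_inside], and [m <= 8 * j]
   because [2 <= m]. The total loss is 64 = 8 * 4 * 2. *)
pose j := (m + 2) %/ 4.
have j_lt i : i < j -> 4 * i + 2 <= m by rewrite /j; lia.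
have jm : j <= #|[set e in OPT :&: Q | #|OPT :&: above e| < j]|.
  by apply: count_prefix upQ _; rewrite -/m /j; lia.
have arith p I S i q : q <= 8 * i -> p * i <= 4 * I -> p * I <= 2 * S -> q * (p * p) <= 64 * S.
  move=> h1 h2 h3; apply: leq_trans (_ : 8 * i * (p * p) <= _); first by rewrite leq_mul2r h1 orbT.
  by nia.
rewrite expn4; apply: (arith _ (\sum_A #|inside A|) _ j).
- by rewrite /j; lia.
- apply: leq_trans (_ : 2 ^ #|T| * #|[set e in OPT :&: Q | #|OPT :&: above e| < j]| <= _).
    by rewrite leq_mul2l jm orbT.
  rewrite sum_inside mulnC -sum_nat_const big_distrr /= big_mkcond [leqRHS]big_mkcond.
  apply: leq_sum => e _; rewrite inE; case: (boolP (e \in _)) => //= eOQ.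
  by case: ltnP => // ej; apply: count_level_inside => //; apply: j_lt.
- by rewrite !big_distrr /=; apply: leq_sum => A _; apply: sumG.
Qed.

End Counting.

(** * From counts to competitive ratios *)

Section Competitive.
Context (R : realType) (g : nat -> nat) (g_homo : {homo g : m n / m <= n}).
Context (d : Order.disp_t) (T : finOrderType d) (M : matroid T) (n : nat).
Context (cardT : #|T| = n).
Local Open Scope ring_scope.

Lemma expect_weight (A : algorithm R n) (w : T -> R) :
  expect_ALG A M (weight w) = \sum_x w x * prob_in_ALG A M x.
Proof.
rewrite /prob_in_ALG /expect_ALG.
under [RHS]eq_bigr do rewrite mulr_sumr.
rewrite exchange_big /=; apply: eq_bigr => s _.
have -> : \sum_(sigma in arrival_orders n T) weight w (ALG M s sigma) =
    \sum_x w x * \sum_(sigma in arrival_orders n T) (x \in ALG M s sigma)%:R.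
  under [RHS]eq_bigr do rewrite mulr_sumr.
  rewrite exchange_big /=; apply: eq_bigr => sigma _; rewrite /weight big_mkcond /=.
  by apply: eq_bigr => x _; case: (_ \in _); rewrite ?mulr1 ?mulr0.
rewrite mulr_suml mulr_sumr; apply: eq_bigr => x _; ring.
Qed.

(* Abel summation: a compatible weight is a nonnegative combination of
   indicators of upward closed sets. *)
Lemma compatible_sum_ge0 (f w : T -> R) : compatible w ->
  (forall z, 0 <= \sum_(x | (z <= x)%O) f x) -> 0 <= \sum_x f x * w x.
Proof.
move=> [w0 wmono] f0.
(* Generalized to decreasing lists with a lower bound [c] on the weights: removing the last element
   [z] raises [c] to [w z]. *)
suff main s c : sorted >%O s -> 0 <= c -> {in s, forall x, c <= w x} ->
    {in s, forall z, 0 <= \sum_(x <- s | (z <= x)%O) f x} ->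
    c * \sum_(x <- s) f x <= \sum_(x <- s) f x * w x.
  pose s := rev (sort <=%O (enum T)).
  have ps : perm_eq s (enum T) by rewrite perm_rev perm_sort.
  have ss : sorted >%O s by rewrite rev_sorted sort_lt_sorted enum_uniq.
  have := main s 0 ss (lexx 0) (fun x _ => w0 x); rewrite mul0r.
  rewrite (perm_big _ ps) /= big_enum; apply=> z _.
  by rewrite (perm_big _ ps) big_enum_cond (eq_bigl (fun x => (z <= x)%O)) /=.
elim/last_ind: s c => [|s z IH] c sz c0 cw s0; first by rewrite !big_nil mulr0.
have zlt : {in s, forall y, (z < y)%O}.
  move=> y ys; move: sz; rewrite -cats1 sorted_pairwise; last first.
    by move=> a b e /= ba eb; apply: lt_trans eb ba.
  by rewrite pairwise_cat => /and3P[/allrelP/(_ y z ys) H _ _]; apply: H; rewrite inE.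
have ss : sorted >%O s by move: sz; rewrite -cats1 => /cat_sorted2[].
have sum0 : 0 <= \sum_(x <- rcons s z) f x.
  have := s0 z; rewrite mem_rcons inE eqxx => /(_ isT); rewrite big_seq_cond.
  rewrite [X in _ -> 0 <= X]big_seq; congr (0 <= _); apply: eq_bigl => x.
  rewrite mem_rcons inE; case: eqP => [->|_]; rewrite ?lexx //=.
  by case: (boolP (x \in s)) => // /zlt/ltW->.
have cz : c <= w z by apply: cw; rewrite mem_rcons inE eqxx.
apply: le_trans (ler_wpM2r sum0 cz) _.
rewrite -cats1 !big_cat !big_seq1 /= mulrDr [f z * _]mulrC lerD2r.
apply: IH => //; first by move=> x /zlt/wmono.
move=> y ys; have := s0 y; rewrite mem_rcons inE ys orbT => /(_ isT).
by rewrite -cats1 big_cat big_cons big_nil [(y <= z)%O]leNgt zlt //= addr0.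
Qed.


Lemma block_prob_in_ALG e : e \in OPT M [set: T] ->
  (forall (A : {set T}) y, e \notin A -> lonely M A e -> active (rk M) (fun y x => (x < y)%O) A y ->
     (y < e)%O -> (level (rk M) (fun y x : T => (x < y)%O) g A e <
                   level (rk M) (fun y x : T => (x < y)%O) g A y)%N) ->
  1 / (8 * (scale_bound g (rank M))%:R) <= prob_in_ALG (block_algorithm R g n) M e.
Proof.
move=> eO sep; have count := count_lonely g_homo eO sep.
apply: le_trans (_ : _ <= _) (@expect_block_ge R g g_homo d T M n cardT _
  (fun A B k => active (rk M) (fun y x => (x < y)%O) A e && wins M g A B k e) _); last first.
  move=> A B k pos inj; case: (boolP (_ && _)) => [/andP[ae we]|_]; last exact: ler0n.
  by rewrite wins_accepted.
set S := (\sum_A _)%N in count *; rewrite natrM invfM mulrA invfM mulrA.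
apply: ler_wpM2r; first by rewrite invr_ge0 ler0n.
rewrite ler_pdivlMr ?ltr0n ?expn_gt0 // mul1r mulrC ler_pdivrMr // mulrC.
by rewrite -natrM ler_nat -cardT.
Qed.

Lemma block_ordinal_competitive : (forall a b, (2 * a < b)%N -> (g a < g b)%N) ->
  ordinal_competitive (block_algorithm R g n) M (64 * (scale_bound g (rank M))%:R).
Proof.
move=> g_double; set K := (scale_bound g (rank M))%:R.
have K0 : 0 < K by rewrite ltr0n.
split=> [|w cw]; first by rewrite mulr_gt0.
rewrite expect_weight -subr_ge0.
set O := OPT M [set: T]; pose P x := prob_in_ALG (block_algorithm R g n) M x.
have -> : \sum_x w x * P x - weight w O / (64 * K) =
    \sum_x (P x - (x \in O)%:R / (64 * K)) * w x.
  rewrite /weight [X in _ - X / _]big_mkcond mulr_suml -sumrB; apply: eq_bigr => x _ /=.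
  by case: (x \in O) => /=; ring.
apply: compatible_sum_ge0 => // z; pose Q := [set x | (z <= x)%O].
have upQ x y : x \in Q -> (x <= y)%O -> y \in Q by rewrite !inE; apply: le_trans.
have [G [GQ count]] := @count_upset g g_homo d T M g_double Q upQ.
have -> : \sum_(x | (z <= x)%O) (P x - (x \in O)%:R / (64 * K)) =
    expect_ALG (block_algorithm R g n) M (weight (fun x => (x \in Q)%:R)) -
    #|O :&: Q|%:R / (64 * K).
  rewrite expect_weight sumrB -mulr_suml; congr (_ - _ / _).
    rewrite big_mkcond; apply: eq_bigr => x _; rewrite inE.
    by case: ifP; rewrite ?mul1r ?mul0r.
  rewrite -natr_sum -sum1_card; congr _%:R.
  rewrite big_mkcond [RHS]big_mkcond; apply: eq_bigr => x _.
  by rewrite !inE andbC; case: (z <= x)%O; case: (x \in O).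
rewrite subr_ge0; apply: le_trans (_ : _ <= _) (@expect_block_ge R g g_homo d T M n cardT _ G _);
  last first.
  move=> A B k pos inj; apply: le_trans (_ : #|accepted M g A B k pos :&: Q|%:R <= _).
    by rewrite ler_nat GQ.
  rewrite -sum1_card natr_sum /weight big_mkcond [leRHS]big_mkcond /=.
  by apply: ler_sum => x _; rewrite inE; case: (x \in accepted _ _ _ _ _ _); case: (x \in Q).
set S := (\sum_A _)%N in count *; rewrite natrM !invfM !mulrA.
apply: ler_wpM2r; first by rewrite invr_ge0 ltW.
rewrite ler_pdivlMr ?ltr0n ?expn_gt0 // mulrAC ler_pdivrMr // mulrC [leRHS]mulrC.
by rewrite -!natrM ler_nat -cardT mulnC.
Qed.

End Competitive.

(** * Bit length and asymptotic bounds *)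

Definition bit_length m := up_log 2 m.+1.

Lemma bit_length_homo : {homo bit_length : m n / m <= n}.
Proof. by move=> m n mn; apply: leq_up_log; rewrite ltnS. Qed.

Lemma bit_length_double a b : 2 * a < b -> bit_length a < bit_length b.
Proof.
by move=> ab; rewrite /bit_length -up_logMp //; apply: leq_up_log; lia.
Qed.

Section Asymptotics.
Context (R : realType).
Local Open Scope ring_scope.

(** With [u] the logarithm on the left, [2 ^ u.-1 < x + 2 <= x ^ 2] bounds [u - 1] by
    [2 * ln x / ln 2]; the remaining 2 is at most the same amount. *)
Lemma up_log_le_ln (x : nat) : (2 <= x)%N ->
  (up_log 2 x.+2).+1%:R <= 4 / ln 2 * ln (x%:R : R).
Proof.
move=> x2; set u := up_log 2 x.+2.
have l2 : 0 < ln (2 : R) by rewrite ln_gt0 // ltr1n.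
have u1 : (0 < u)%N by rewrite up_log_gt0.
have lu : u.-1%:R * ln (2 : R) <= 2 * ln (x%:R : R).
  have x0 : 0 < x%:R :> R by rewrite ltr0n; lia.
  rewrite !mulr_natl -!lnXn // -!natrX ler_ln ?posrE ?ltr0n ?expn_gt0 ?ler_nat; last 2 first.
  - by [].
  - by lia.
  by have := @up_log_gtn 2 x.+2 isT isT; rewrite -/u; nia.
have lx : ln (2 : R) <= ln x%:R by rewrite ler_ln ?posrE ?ltr0n ?ler_nat //; lia.
rewrite mulrAC ler_pdivlMr // -natr1; have -> : u = u.-1.+1 by lia.
by rewrite -natr1 /= in lu *; lra.
Qed.

Local Open Scope classical_set_scope.

Lemma scale_bound_id_ln :
  (fun m => 8 * (scale_bound id m)%:R : R) =O_\oo (fun m : nat => ln m%:R : R).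
Proof.
have l2 : 0 < ln (2 : R) by rewrite ln_gt0 // ltr1n.
apply/eqO_exP; exists (32 / ln 2) => //; first by rewrite divr_gt0.
near=> m; have m2 : (2 <= m)%N by near: m; exists 2%N.
have lm : 0 <= ln (m%:R : R) by rewrite ln_ge0 // ler1n; lia.
have := up_log_le_ln m2; rewrite (ger0_norm lm) ger0_norm ?mulr_ge0 //.
by rewrite /scale_bound /=; lra.
Unshelve. all: by end_near. Qed.

Lemma scale_bound_bit_length_ln :
  (fun m => 64 * (scale_bound bit_length m)%:R : R) =O_\oo
  (fun m : nat => ln (ln m%:R) : R).
Proof.
have l2 : 0 < ln (2 : R) by rewrite ln_gt0 // ltr1n.
pose c : R := 4 / ln 2.
have c1 : 1 <= c.
  rewrite ler_pdivlMr // mul1r; apply: le_trans (ltW (ln_sublinear _)) _; first by [].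
  by rewrite ler_nat.
(* For [ln m >= c] the scale bound is at most [c * (ln c + ln (ln m))], hence at most
   [2 * c * ln (ln m)], and 128 is [64 * 2]. *)
apply/eqO_exP; exists (128 * c) => //; first lra.
near=> m; have m2 : (2 <= m)%N by near: m; exists 2%N.
have mc : expR c <= m%:R by near: m; exact: nbhs_infty_ger.
have lm : c <= ln (m%:R : R).
  by rewrite -[c]expRK ler_ln ?posrE ?expR_gt0 // ltr0n; lia.
have b2 : (2 <= bit_length m)%N.
  by apply: leq_trans (bit_length_homo m2); rewrite /bit_length (@up_log_eq 2 1).
have up1 := up_log_le_ln b2.
have up2 : (bit_length m)%:R <= c * ln (m%:R : R).
  apply: le_trans (up_log_le_ln m2); rewrite ler_nat.
  by apply: leq_trans (leqnSn _); apply: leq_up_log.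
have llm : ln c <= ln (ln (m%:R : R)) by rewrite ler_ln ?posrE //; lra.
have lb : ln ((bit_length m)%:R : R) <= ln c + ln (ln (m%:R : R)).
  rewrite -lnM ?posrE; [|lra|lra]; rewrite ler_ln ?posrE ?ltr0n //; first by lia.
  by rewrite mulr_gt0; lra.
have ll0 : 0 <= ln (ln (m%:R : R)) by rewrite ln_ge0; lra.
rewrite (ger0_norm ll0) ger0_norm ?mulr_ge0 //.
have := le_trans up1 (ler_wpM2l _ lb); rewrite -/c => /(_ ltac:(lra)) H.
rewrite /scale_bound; nra.
Unshelve. all: by end_near. Qed.

End Asymptotics.

Local Open Scope ring_scope.
Local Open Scope classical_set_scope.

Theorem theorem2 (R : realType) :
  (exists (A : forall n, algorithm R n) (alpha : nat -> R),
     ordinal_competitive_family A alpha /\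
     alpha =O_\oo (fun rho : nat => ln (ln rho%:R) : R)) /\
  (exists (A : forall n, algorithm R n) (alpha : nat -> R),
     probability_competitive_family A alpha /\
     alpha =O_\oo (fun rho : nat => ln rho%:R : R)).
Proof.
split.
  exists (block_algorithm R bit_length), (fun m => 64 * (scale_bound bit_length m)%:R).
  split; last exact: scale_bound_bit_length_ln.
  move=> n d T M cardT; split.
    exact: block_keeps_independent bit_length_homo _ _ _ _ cardT.
  exact: block_ordinal_competitive bit_length_homo _ _ _ _ cardT bit_length_double.
exists (block_algorithm R id), (fun m => 8 * (scale_bound id m)%:R).
split; last exact: scale_bound_id_ln.
have id_homo : {homo (@id nat) : m n / (m <= n)%N} by [].
move=> n d T M cardT; split; first exact: block_keeps_independent id_homo _ _ _ _ cardT.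
split=> [|e eO]; first by rewrite mulr_gt0 // ltr0n.
(* For [g] the identity, levels are ranks, so being lonely is the required separation of levels. *)
apply: (block_prob_in_ALG R id_homo cardT eO) => A y eA /forallP/(_ y)/implyP sep ya ye.
by apply: sep; rewrite ya.
Qed.
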